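(* Let $r,s\ge0$ be integers, let $x,y$ be distinct vertices of $B_{r,s}=P_3^{\square r}\square Q_s$, and assume that $H=B_{r,s}-\{x,y\}$ is nonempty. Then $H$ is an isometric subgraph of $B_{r,s}$ if and only if one of the following holds: (1) $x,y$ are corners and $(p(x,y),q(x,y))\ne(0,2)$; (2) $\{x,y\}$ is a boundary $P_3$-edge.
   Context: $P_3$ is the path on three vertices, $Q_s$ the hypercube on $\{0,1\}^s$, $\square$ the Cartesian product, $G^{\square0}=Q_0=K_1$. Coordinate model: $V(B_{r,s})=\{0,1,2\}^r\times\{0,1\}^s$, two vertices being adjacent iff they differ in exactly one coordinate and there by exactly $1$. The first $r$ coordinates are the $P_3$-coordinates, the last $s$ the binary coordinates. A corner is a vertex all of whose $P_3$-coordinates lie in $\{0,2\}$. For vertices $x,y$: $p(x,y)=|\{i\in[r]:\{x_i,y_i\}=\{0,2\}\}|$ and $q(x,y)=|\{j\in[s]:x_{r+j}\ne y_{r+j}\}|$. $\{x,y\}$ is a boundary $P_3$-edge if $x,y$ are adjacent, differ in a $P_3$-coordinate, and one of them is a corner. $B_{r,s}-\{x,y\}$ is the subgraph induced by the remaining vertices. A subgraph $H$ of $G$ is isometric if $d_H(u,v)=d_G(u,v)$ for all $u,v\in V(H)$ (with distance $\infty$ between different components, so an isometric subgraph of a connected graph is connected). *)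

(* Defs.v *)
From mathcomp Require Import all_boot.

Set Implicit Arguments.
Unset Strict Implicit.
Unset Printing Implicit Defensive.

Section Graphs.

Variables (T : finType) (e : rel T).

Definition walk (u v : T) (n : nat) : bool :=
  [exists p : n.-tuple T, path e u p && (last u p == v)].

Lemma walk_ex (u v : T) : connect e u v -> exists n, walk u v n.
Proof.
case/connectP=> p e_p ->; exists (size p).
by apply/existsP; exists (in_tuple p); rewrite e_p eqxx.
Qed.

(* [None] stands for the infinite distance between different components. *)
Definition dist (u v : T) : option nat :=
  if @idP (connect e u v) is ReflectT uv then Some (ex_minn (walk_ex uv))
  else None.

End Graphs.

Section Subgraphs.

Variables (T : finType) (e : rel T).

Definition induced (A : {set T}) : rel {u : T | u \in A} :=
  fun u v => e (val u) (val v).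

(* [h] is the edge relation of a subgraph of [e] with vertex set [A]. *)
Definition isometric (A : {set T}) (h : rel {u : T | u \in A}) : Prop :=
  forall u v : {u : T | u \in A}, dist h u v = dist e (val u) (val v).

End Subgraphs.

Arguments induced {T} e A.

Definition cart (T1 T2 : finType) (e1 : rel T1) (e2 : rel T2) :
    rel (T1 * T2) :=
  fun x y => (e1 x.1 y.1 && (x.2 == y.2)) || ((x.1 == y.1) && e2 x.2 y.2).

(* The [n]-fold Cartesian power, as a graph on functions; for [n = 0] it is
   the one-vertex graph. *)
Definition cart_pow (T : finType) (e : rel T) (n : nat) :
    rel {ffun 'I_n -> T} :=
  fun x y => [exists i, e (x i) (y i) && [forall (j | j != i), x j == y j]].

Definition P3 : rel 'I_3 := fun a b => (a.+1 == b) || (b.+1 == a).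

Definition hypercube (s : nat) : rel {ffun 'I_s -> bool} :=
  fun x y => #|[set j | x j != y j]| == 1.

Notation Bvertex r s := ({ffun 'I_r -> 'I_3} * {ffun 'I_s -> bool})%type.

Definition B (r s : nat) : rel (Bvertex r s) :=
  cart (cart_pow P3 (n := r)) (@hypercube s).

Section Coordinates.

Variables r s : nat.
Implicit Types x y : Bvertex r s.

Definition corner x : bool :=
  [forall i, x.1 i \in [set ord0; ord_max]].

Definition p x y : nat :=
  #|[set i | [set x.1 i; y.1 i] == [set ord0; ord_max]]|.

Definition q x y : nat := #|[set j | x.2 j != y.2 j]|.

Definition boundary_P3_edge x y : bool :=
  [&& B x y, [exists i, x.1 i != y.1 i] & corner x || corner y].

(* The coordinate model: adjacent vertices differ in exactly one coordinate,
   and there by exactly 1 (automatic in a binary coordinate). *)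
Lemma B_coord x y :
  B x y = (#|[set i | x.1 i != y.1 i]| + q x y == 1) &&
          [forall (i | x.1 i != y.1 i), P3 (x.1 i) (y.1 i)].
Proof.
have P3ne a b : P3 a b -> a != b.
  apply: contraL => /eqP->.
  by rewrite /P3 orbb -{2}[val b]addn0 -addn1 eqn_add2l.
have card0E (I : finType) (U : eqType) (f g : {ffun I -> U}) :
    (#|[set i | f i != g i]| == 0) = [forall i, f i == g i].
  rewrite cards_eq0; apply/eqP/forallP => [fg0 i | fg].
    by move/setP/(_ i): fg0; rewrite !inE; case: eqP.
  by apply/setP=> i; rewrite !inE fg.
have ffE (I : finType) (U : eqType) (f g : {ffun I -> U}) :
    (f == g) = (#|[set i | f i != g i]| == 0).
  rewrite card0E; apply/eqP/forallP => [-> //| fg].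
  by apply/ffunP=> i; apply/eqP.
have powE : cart_pow P3 x.1 y.1 = (#|[set i | x.1 i != y.1 i]| == 1) &&
    [forall (i | x.1 i != y.1 i), P3 (x.1 i) (y.1 i)].
  apply/existsP/andP => [[i /andP[xyi /forall_inP xyE]] |
                         [/cards1P[i xyE] /forall_inP xyP]].
    have D j : (x.1 j != y.1 j) = (j == i).
      have [->|ji] := eqVneq j i; first by rewrite P3ne.
      by rewrite (xyE j ji).
    split; last by apply/forall_inP=> j; rewrite D => /eqP->.
    by apply/cards1P; exists i; apply/setP=> j; rewrite !inE D.
  have D j : (x.1 j != y.1 j) = (j == i) by move/setP/(_ j): xyE; rewrite !inE.
  exists i; rewrite xyP ?D //=.
  by apply/forall_inP=> j; rewrite -D negbK.
rewrite /B /cart powE !ffE /hypercube -/(q x y).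
case: (posnP #|[set i | x.1 i != y.1 i]|) => [d0|].
  rewrite d0 /= add0n; case: eqP => //= _; apply/esym/forall_inP => i.
  by move/eqP: d0; rewrite card0E => /forallP/(_ i) ->.
case: #|_| => // d _ /=; rewrite orbF andbAC addSn !eqSS addn_eq0.
by rewrite -andbA andbC -!andbA andbC -andbA.
Qed.

End Coordinates.

(* Main.v *)
Require Import Defs.
From mathcomp Require Import all_boot zify.

(** The distance in [B r s] is the L1 distance of the coordinates: the
    neighbours of [u] that are closer to [v] are the vertices [move u v k], one
    for each coordinate [k] in which [u] and [v] differ.  Descending along the
    distance, an induced subgraph is therefore isometric exactly when it has no
    blocked pair, i.e. no two distinct remaining vertices [u], [v] such that
    every [move u v k] has been deleted ([isometric_unblockedP]).

    When only [x] and [y] are deleted, a blocked pair differs in at most two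
    coordinates, because the moves in different coordinates are distinct.

    - If [u] and [v] differ in the coordinate [k] alone, then the move is not
      [v], so [k] is a P3-coordinate, [u] and [v] have the values 0 and 2 there,
      and the deleted vertex between them has the value 1.  Hence only a deleted
      vertex that is not a corner can block this way, and it does so in each of
      its coordinates equal to 1 unless the other deleted vertex is one of the
      two ends.  The exception forces a boundary P3-edge
      ([noncorner_boundary]), and a boundary P3-edge always falls under it.

    - If they differ in two coordinates, then the two moves are [x] and [y], so
      [x] and [y] are opposite in the 4-cycle spanned by [u] and [v]; they are
      not adjacent, and they differ by 1 in exactly these two coordinates.  Two
      corners never differ by 1 in a P3-coordinate, so both coordinates are
      binary and [(p, q) = (0, 2)].  Conversely such corners do block the other
      two vertices of their 4-cycle ([corners_pq02_obstruct]). *)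

Set Implicit Arguments.
Unset Strict Implicit.
Unset Printing Implicit Defensive.

(** * Distances from a potential, and isometric induced subgraphs *)

Section Distances.

Variables (T : finType) (e : rel T).

Lemma walk0 u v : walk e u v 0 = (u == v).
Proof.
apply/existsP/eqP => [[t]|->]; first by rewrite tuple0 /= => /eqP.
by exists [tuple] => /=.
Qed.

Lemma walkS u v n : walk e u v n.+1 = [exists w, e u w && walk e w v n].
Proof.
apply/existsP/existsP => [[t]|[w /andP[uw /existsP[t /andP[pt lt]]]]].
  case/tupleP: t => w t /= /andP[/andP[uw pt] lt].
  by exists w; rewrite uw; apply/existsP; exists t; rewrite pt.
by exists [tuple of w :: t]; rewrite /= uw pt.
Qed.

Lemma walk_connect u v n : walk e u v n -> connect e u v.
Proof. by case/existsP=> t /andP[pt /eqP <-]; apply/connectP; exists t. Qed.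

Lemma dist_SomeP u v n :
  dist e u v = Some n <-> walk e u v n /\ forall m, walk e u v m -> n <= m.
Proof.
rewrite /dist; case: {-}_ / idP => [uv|nuv]; last first.
  by split=> // -[/walk_connect uv].
case: ex_minnP => m wm minm; split=> [[<-] //|[wn minn]].
by congr Some; apply/eqP; rewrite eqn_leq minm //= minn.
Qed.

(** An edge lowers [d _ v] by at most one, which bounds every walk from below,
    and some edge always lowers it, which produces a walk of length [d u v]. *)
Lemma dist_potential (d : T -> T -> nat) :
    (forall u v, d u v = 0 <-> u = v) ->
    (forall u w v, e u w -> d u v <= (d w v).+1) ->
    (forall u v, u != v -> exists2 w, e u w & d u v = (d w v).+1) ->
  forall u v, dist e u v = Some (d u v).
Proof.
move=> d0 d_le d_step u v; apply/dist_SomeP; split.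
  move En: (d u v) => n; elim: n u En => [|n IHn] u En.
    by rewrite walk0; apply/eqP/d0.
  have uv: u != v by apply/eqP => /d0; rewrite En.
  have [w uw] := d_step _ _ uv; rewrite En walkS => -[dw].
  by apply/existsP; exists w; rewrite uw IHn.
move=> m; elim: m u => [|m IHm] u; first by rewrite walk0 => /eqP/d0->.
by rewrite walkS => /existsP[w /andP[uw /IHm wm]]; apply: leq_trans (d_le _ _ v uw) _.
Qed.

End Distances.

(** If the descent can always stay in [A], then [d] is also the distance of the
    induced subgraph, by [dist_potential]; conversely the first step of a
    shortest walk inside [A] is such a descent. *)
Lemma isometric_inducedP (T : finType) (e : rel T) (d : T -> T -> nat) (A : {set T}) :
    (forall u v, d u v = 0 <-> u = v) ->
    (forall u w v, e u w -> d u v <= (d w v).+1) ->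
    (forall u v, u != v -> exists2 w, e u w & d u v = (d w v).+1) ->
  isometric e (induced e A) <->
  {in A &, forall u v, u != v ->
     exists w, [/\ w \in A, e u w & d u v = (d w v).+1]}.
Proof.
move=> d0 d_le d_step; have dE := dist_potential d0 d_le d_step.
split=> [isoA u v uA vA uv | stepA u v]; last first.
  rewrite dE.
  pose dA (a b : {z | z \in A}) := d (val a) (val b).
  rewrite -/(dA u v).
  move: u v; apply: dist_potential => [u v|u w v|u v uv].
  - by split=> [/d0/val_inj|/(congr1 val)/d0].
  - exact: d_le.
  - have [w [wA uw dw]] := stepA _ _ (valP u) (valP v) uv.
    by exists (Sub w wA); rewrite /induced /dA ?SubK.
have /dist_SomeP[] : dist (induced e A) (Sub u uA) (Sub v vA) = Some (d u v).
  by rewrite isoA dE.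
case En: (d u v) => [|n]; first by move/d0/eqP: En; rewrite (negPf uv).
rewrite walkS => /existsP[w /andP[uw wv]] _.
exists (val w); split=> //; first exact: valP.
have /dist_SomeP[_ /(_ n)] := dE (val w) v.
have: walk e (val w) v n.
  elim: (n) (w) wv => [|k IHk] z; rewrite ?walk0 ?walkS.
    by move/eqP->.
  case/existsP=> z' /andP[zz' /IHk z'v].
  by apply/existsP; exists (val z'); rewrite z'v andbT.
have := d_le _ _ v uw; rewrite /= En => le1 wk /(_ wk) le2.
by apply/eqP; rewrite eqSS eqn_leq le2 andbT.
Qed.

(** * Coordinates and the L1 distance *)

Section Coordinates.

Variables r s : nat.
Implicit Types (x y u v w : Bvertex r s) (k l : 'I_r + 'I_s).

(** Both kinds of coordinates are read as numbers, so that P3-coordinates and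
    binary coordinates can be treated together: they differ only in their
    largest value. *)
Definition crd x k : nat :=
  match k with inl i => x.1 i | inr j => x.2 j end.

Definition crd_max k : nat := if k is inl _ then 2 else 1.

Definition upd x k (a : nat) : Bvertex r s :=
  match k with
  | inl i => ([ffun j => if j == i then inord a else x.1 j], x.2)
  | inr i => (x.1, [ffun j => if j == i then a == 1 else x.2 j])
  end.

Lemma crd_le x k : crd x k <= crd_max k.
Proof. by case: k => i /=; [rewrite -ltnS | case: (x.2 i)]. Qed.

Lemma crd_inj x y : crd x =1 crd y -> x = y.
Proof.
case: x y => [x1 x2] [y1 y2] xy; congr (_, _); apply/ffunP => i.
  exact/val_inj/(xy (inl i)).
by have /= := xy (inr i); case: (x2 i); case: (y2 i).
Qed.

Lemma crd_upd x k a l :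
  a <= crd_max k -> crd (upd x k a) l = if l == k then a else crd x l.
Proof.
case: k l => i [j|j] //= a_le; rewrite ffunE -?[inl _ == _]/(j == i)
  -?[inr _ == _]/(j == i); case: eqP => // _; first by rewrite inordK.
by case: a a_le => [|[]].
Qed.

Lemma B_crdP x y :
  reflect (exists2 k, crd y k = (crd x k).+1 \/ crd x k = (crd y k).+1
                    & forall l, l != k -> crd x l = crd y l)
          (B x y).
Proof.
apply: (iffP orP) => [[]|[[i|i] xyi xyE]].
- case/andP=> /existsP[i /andP[xyi /forall_inP xyE]] /eqP xy2.
  exists (inl i) => [|[j|j] //= ji]; first by case/orP: xyi => /eqP; auto.
    by rewrite (eqP (xyE j ji)).
  by rewrite xy2.
- case/andP=> /eqP xy1 /cards1P[i /setP xyE].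
  have D j : (x.2 j != y.2 j) = (j == i) by have := xyE j; rewrite !inE.
  exists (inr i) => [|[j|j] //= ji]; last 2 first.
  + by rewrite xy1.
  + move: ji; rewrite -[inr j == _]/(j == i) -D negbK.
    by move/eqP->.
  by have := D i => /=; rewrite eqxx; case: (x.2 i); case: (y.2 i) => //; auto.
- left; apply/andP; split; last first.
    by apply/eqP/ffunP => j; have /= := xyE (inr j) isT; case: (x.2 j); case: (y.2 j).
  apply/existsP; exists i; apply/andP; split.
    by rewrite /P3; case: xyi => /= ->; rewrite eqxx ?orbT.
  by apply/forall_inP => j ji; apply/eqP/val_inj/(xyE (inl j)).
right; apply/andP; split.
  by apply/eqP/ffunP => j; apply/val_inj/(xyE (inl j)).
apply/cards1P; exists i; apply/setP => j; rewrite !inE.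
have [->|ji] := eqVneq j i.
  by case: xyi => /=; case: (x.2 i); case: (y.2 i).
by have /= := xyE (inr j) ji; case: (x.2 j); case: (y.2 j).
Qed.

Lemma B_sym x y : B x y = B y x.
Proof.
by apply/B_crdP/B_crdP => -[k xyk xyE]; exists k; [case: xyk; auto | move=> l /xyE
  | case: xyk; auto | move=> l /xyE].
Qed.

Definition absdiff (a b : nat) := (a - b) + (b - a).

Definition l1 u v : nat := \sum_k absdiff (crd u k) (crd v k).

Lemma l1_eq0 u v : l1 u v = 0 <-> u = v.
Proof.
split=> [/eqP|->]; last by apply: big1 => k _; rewrite /absdiff subnn.
rewrite sum_nat_eq0 => /forallP uv; apply: crd_inj => k.
by have := uv k; rewrite /absdiff /=; lia.
Qed.

Lemma l1D1 k u v :
  l1 u v = absdiff (crd u k) (crd v k) + \sum_(l | l != k) absdiff (crd u l) (crd v l).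
Proof. by rewrite /l1 (bigD1 k). Qed.

Lemma eq_l1_rest k u w v : (forall l, l != k -> crd u l = crd w l) ->
  \sum_(l | l != k) absdiff (crd u l) (crd v l) =
  \sum_(l | l != k) absdiff (crd w l) (crd v l).
Proof. by move=> uw; apply: eq_bigr => l /uw->. Qed.

Lemma l1_edge u w v : B u w -> l1 u v <= (l1 w v).+1.
Proof.
case/B_crdP=> k uwk uwE; rewrite !(l1D1 k) (eq_l1_rest v uwE) /absdiff; lia.
Qed.

(** The neighbour of [u] one step closer to [v] in the coordinate [k]; it is
    meaningful only when [u] and [v] differ there. *)
Definition move u v k : Bvertex r s :=
  upd u k (if crd u k < crd v k then (crd u k).+1 else (crd u k).-1).

Lemma crd_move u v k l : crd u k != crd v k -> crd (move u v k) l =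
  if l == k then if crd u k < crd v k then (crd u k).+1 else (crd u k).-1
  else crd u l.
Proof.
move=> uvk; rewrite crd_upd //; have := crd_le u k; have := crd_le v k.
by case: ifP; lia.
Qed.

Lemma crd_neqP u v : reflect (exists k, crd u k != crd v k) (u != v).
Proof.
apply: (iffP idP) => [uv|[k]]; last by apply: contraNneq => ->.
apply/existsP; apply: contraNT uv; rewrite negb_exists => /forallP uv.
by apply/eqP/crd_inj => k; apply/eqP; rewrite -[_ == _]negbK.
Qed.

Lemma geodesic_stepP u v w :
  (B u w /\ l1 u v = (l1 w v).+1) <->
  (exists2 k, crd u k != crd v k & w = move u v k).
Proof.
split=> [[/B_crdP[k uwk uwE]]|[k uvk ->]].
  rewrite !(l1D1 k) (eq_l1_rest v uwE) /absdiff => duw.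
  have uvk : crd u k != crd v k by lia.
  exists k => //; apply: crd_inj => l; rewrite crd_move //.
  by have [->|/uwE->//] := eqVneq l k; case: ifP; lia.
have mE l : l != k -> crd u l = crd (move u v k) l.
  by move=> lk; rewrite crd_move // (negPf lk).
have mk := crd_move k uvk; rewrite eqxx in mk.
split; first by apply/B_crdP; exists k => //; rewrite mk; case: ifP; lia.
by rewrite !(l1D1 k) (eq_l1_rest v mE) mk /absdiff; case: ifP; lia.
Qed.

Definition unblocked (A : {set Bvertex r s}) : Prop :=
  {in A &, forall u v, u != v ->
     exists2 k, crd u k != crd v k & move u v k \in A}.

(** The combinatorial form of isometry on which the rest depends: by
    [geodesic_stepP] the descending edges of the L1 distance are the moves. *)
Lemma isometric_unblockedP (A : {set Bvertex r s}) :
  isometric (@B r s) (induced (@B r s) A) <-> unblocked A.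
Proof.
have step u v : u != v -> exists2 w, B u w & l1 u v = (l1 w v).+1.
  move=> /crd_neqP[k uvk].
  have [|uw duw] := (geodesic_stepP u v (move u v k)).2; first by exists k.
  by exists (move u v k).
have isoP := isometric_inducedP A l1_eq0 l1_edge step.
split=> [/isoP isoA u v uA vA /isoA-/(_ uA vA)[w [wA uw duw]]|moveA].
  have [k uvk wE] := (geodesic_stepP u v w).1 (conj uw duw).
  by exists k => //; rewrite -wE.
apply/isoP => u v uA vA /moveA-/(_ uA vA)[k uvk mA].
have [|uw duw] := (geodesic_stepP u v (move u v k)).2; first by exists k.
by exists (move u v k).
Qed.

Lemma cornerP x : reflect (forall i, crd x (inl i) <> 1) (corner x).
Proof.
apply: (iffP forallP) => cx i; have := cx i; rewrite !inE -!val_eqE /=; first lia.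
by have := ltn_ord (x.1 i); lia.
Qed.

Lemma notin_pair x y u : (u \in ~: [set x; y]) = (u != x) && (u != y).
Proof. by rewrite !inE negb_or. Qed.

(** * Deleting two vertices *)

(** If [x] has the value 1 in a P3-coordinate [i], then it is the only vertex
    between the copies of [x] with [x_i] replaced by 0 and by 2.  As [x] is
    deleted, one of these copies must be deleted as well, so it is [y].  This
    holds for every such [i], and [y] differs from [x] in just one coordinate:
    hence there is only one such [i], and [y] is a corner. *)
Lemma noncorner_boundary x y :
    unblocked (~: [set x; y]) ->
  ~~ corner x -> boundary_P3_edge x y.
Proof.
move=> free ncx.
(* y replaces every coordinate of x that equals 1 by 0 or 2. *)
have yE i : crd x (inl i) = 1 -> exists2 a, a \in [:: 0; 2] & y = upd x (inl i) a.
  move=> xi; set k : 'I_r + 'I_s := inl i in xi *.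
  have cu a l : a <= 2 -> crd (upd x k a) l = if l == k then a else crd x l.
    by move=> a2; apply: crd_upd.
  have nx a : a \in [:: 0; 2] -> upd x k a != x.
    move=> a02; apply/crd_neqP; exists k; rewrite cu ?eqxx ?xi.
      by move: a02; rewrite !inE; lia.
    by move: a02; rewrite !inE; lia.
  have [->|y0] := eqVneq y (upd x k 0); first by exists 0.
  have [->|y2] := eqVneq y (upd x k 2); first by exists 2.
  have [|||l] := free (upd x k 0) (upd x k 2).
  - by rewrite notin_pair nx // eq_sym.
  - by rewrite notin_pair nx // eq_sym.
  - by apply/crd_neqP; exists k; rewrite !cu // eqxx.
  rewrite !cu //; case: (l =P k) => [->|_]; last by rewrite eqxx.
  move=> _; suff -> : move (upd x k 0) (upd x k 2) k = x by rewrite notin_pair eqxx.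
  apply: crd_inj => l'; rewrite crd_move !cu // eqxx //=.
  by case: eqP => // ->.
have [i xi] : exists i, crd x (inl i) = 1.
  move: ncx; rewrite negb_forall => /existsP[i xi]; exists i.
  move: xi; rewrite !inE -!val_eqE /=; have := ltn_ord (x.1 i); lia.
have ycrd j a l : a \in [:: 0; 2] ->
    crd (upd x (inl j) a) l = if l == inl j then a else crd x l.
  by move=> a02; apply: crd_upd; move: a02; rewrite !inE /=; lia.
have [a a02 ya] := yE _ xi.
have yi : crd y (inl i) = a by rewrite ya ycrd // eqxx.
apply/and3P; split.
- apply/B_crdP; exists (inl i); first by rewrite xi yi; move: a02; rewrite !inE; lia.
  by move=> l li; rewrite ya ycrd // (negPf li).
- apply/existsP; exists i; rewrite -val_eqE -[val _]/(crd x (inl i)).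
  by rewrite -[X in _ != X]/(crd y (inl i)) xi yi; move: a02; rewrite !inE; lia.
(* A coordinate j with y_j = 1 would have x_j = 1 too, as only the 1 at i has
   changed, but then y_j is 0 or 2. *)
apply/orP; right; apply/cornerP => j yj.
have [/yE[b b02 yb]|xj] := eqVneq (crd x (inl j)) 1.
  by move: yj; rewrite yb ycrd // eqxx; move: b02; rewrite !inE; lia.
move: yj; rewrite ya ycrd //; case: eqP => [_|_]; last exact/eqP.
by move: a02; rewrite !inE; lia.
Qed.

Lemma boundary_P3_edge_sym x y : boundary_P3_edge x y = boundary_P3_edge y x.
Proof.
rewrite /boundary_P3_edge B_sym orbC; congr [&& _, _ & _].
by apply: eq_existsb => i; rewrite eq_sym.
Qed.

(** Two distinct values of corners in a P3-coordinate are always 0 and 2, so [p]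
    counts all the P3-coordinates in which two corners differ. *)
Lemma corner_p_eq0 x y : corner x -> corner y -> (p x y == 0) = (x.1 == y.1).
Proof.
move=> /forallP cx /forallP cy; rewrite cards_eq0; apply/eqP/eqP => [/setP pE|->].
  apply/ffunP => i; have := pE i; have := cx i; have := cy i; rewrite !inE.
  by do 2![case/orP=> /eqP->] => //; rewrite 1?setUC eqxx.
apply/setP => i; rewrite !inE setUid; apply/negbTE/negP => /eqP E.
by have := congr1 (fun A : {set _} => #|A|) E; rewrite cards1 cards2.
Qed.

Lemma corners_pq02P x y : corner x -> corner y ->
  (p x y, q x y) = (0, 2) <->
  exists i j : 'I_s, i != j /\
    forall k, (crd x k != crd y k) = ((k == inr i) || (k == inr j)).
Proof.
move=> cx cy; split=> [[/eqP]|[i [j [ij D]]]].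
  rewrite corner_p_eq0 // => /eqP xy1; rewrite /q => /eqP/cards2P[i [j [ij /setP D]]].
  exists i, j; split=> // -[k|k] /=; first by rewrite xy1 eqxx.
  have := D k; rewrite !inE -[(inr k == inr i)]/(k == i) -[(inr k == inr j)]/(k == j).
  by move=> <-; case: (x.2 k); case: (y.2 k).
congr (_, _).
  apply/eqP; rewrite corner_p_eq0 //; apply/eqP/ffunP => k; apply/val_inj/eqP.
  by have := D (inl k); rewrite /= => /negbFE.
apply/eqP/cards2P; exists i, j; split=> //; apply/setP => k; rewrite !inE.
have := D (inr k); rewrite -[(inr k == inr i)]/(k == i) -[(inr k == inr j)]/(k == j).
by move=> <- /=; case: (x.2 k); case: (y.2 k).
Qed.

(** [x] and [y] are opposite vertices of a 4-cycle; its other two vertices have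
    no common neighbour besides them. *)
Lemma corners_pq02_obstruct x y : corner x -> corner y ->
    unblocked (~: [set x; y]) ->
  (p x y, q x y) <> (0, 2).
Proof.
move=> cx cy free pq; have [i [j [ij D]]] := (corners_pq02P cx cy).1 pq.
set ki : 'I_r + 'I_s := inr i in D; set kj : 'I_r + 'I_s := inr j in D.
have kij : ki != kj by [].
have kji : kj != ki by rewrite eq_sym.
have [Di Dj] : crd x ki != crd y ki /\ crd x kj != crd y kj.
  by rewrite !D !eqxx orbT.
have cE k l : crd (upd x k (crd y k)) l = if l == k then crd y k else crd x l.
  by rewrite crd_upd ?crd_le.
set u := upd x ki (crd y ki); set v := upd x kj (crd y kj).
have [|||k] := free u v.
- rewrite notin_pair; apply/andP; split; apply/crd_neqP.
    by exists ki; rewrite cE eqxx eq_sym.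
  by exists kj; rewrite cE (negPf kji).
- rewrite notin_pair; apply/andP; split; apply/crd_neqP.
    by exists kj; rewrite cE eqxx eq_sym.
  by exists ki; rewrite cE (negPf kij).
- by apply/crd_neqP; exists ki; rewrite !cE eqxx (negPf kij) eq_sym.
have bin z : crd z ki <= 1 /\ crd z kj <= 1 by split; apply: crd_le.
have [[xi1 xj1] [yi1 yj1]] := (bin x, bin y).
move=> uvk; apply/negP; rewrite notin_pair negb_and !negbK.
have : (k == ki) || (k == kj).
  by apply: contraNT uvk; rewrite negb_or !cE => /andP[/negPf-> /negPf->].
case/orP=> /eqP kE; rewrite {k}kE in uvk *; apply/orP; [left|right];
  apply/eqP/crd_inj => l; rewrite crd_move // !cE !eqxx.
  rewrite (negPf kij); case: (l =P ki) => // ->; case: ifP; lia.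
rewrite (negPf kji); case: (eqVneq l kj) => [->|lj].
  by case: ifP; lia.
case: (l =P ki) => [->//|/eqP li]; apply/eqP.
by have := D l; rewrite (negPf li) (negPf lj) => /negbFE.
Qed.

(** The values of corners in a P3-coordinate are 0 or 2, so a difference of 1 can
    only occur in a binary coordinate. *)
Lemma corners_diff1_pq02 x y k k' : corner x -> corner y -> k != k' ->
  (forall l, (crd x l != crd y l) = ((l == k) || (l == k'))) ->
  absdiff (crd x k) (crd y k) = 1 -> absdiff (crd x k') (crd y k') = 1 ->
  (p x y, q x y) = (0, 2).
Proof.
move=> cx cy; have binary i : absdiff (crd x (inl i)) (crd y (inl i)) <> 1.
  move/cornerP/(_ i): cx; move/cornerP/(_ i): cy.
  have := crd_le x (inl i); have := crd_le y (inl i); rewrite /absdiff /crd_max; lia.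
case: k k' => [i|i] [j|j] // ij D xyi xyj; try by case: (binary _ xyi).
  by case: (binary _ xyj).
by apply/corners_pq02P => //; exists i, j.
Qed.

(** Here [u], [v] would be a blocked pair, and [k] the coordinate whose move is
    [x].  The roles of [x] and [y] can be exchanged, so excluding this case
    excludes blocked pairs altogether. *)
Lemma blocked_move_neq x y u v :
    (corner x /\ corner y /\ (p x y, q x y) <> (0, 2)) \/ boundary_P3_edge x y ->
    v != x -> u != y -> v != y ->
    (forall k, crd u k != crd v k -> move u v k = x \/ move u v k = y) ->
  forall k, crd u k != crd v k -> move u v k <> x.
Proof.
move=> hyp vx uy vy blocked k uvk mx.
have xE l : crd x l = if l == k then if crd u k < crd v k then (crd u k).+1
    else (crd u k).-1 else crd u l by rewrite -mx crd_move.
(* Either u and v differ in a second coordinate k', whose move must be y... *)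
have [k' /andP[k'k uvk']|kD] := pickP (fun k' => (k' != k) && (crd u k' != crd v k')).
  have [mx'|my] := blocked _ uvk'.
    have := crd_move k' uvk'; rewrite mx' xE (negPf k'k) eqxx; case: ifP; lia.
  have yE l := crd_move l uvk'; rewrite my in yE.
  have [xyk xyk'] : absdiff (crd x k) (crd y k) = 1 /\ absdiff (crd x k') (crd y k') = 1.
    rewrite !xE !yE !eqxx (negPf k'k) eq_sym (negPf k'k) /absdiff.
    by split; case: ifP; lia.
  have D l : (crd x l != crd y l) = ((l == k) || (l == k')).
    have [->|lk] := eqVneq l k; first by move: xyk; rewrite /absdiff /=; lia.
    have [->|lk'] := eqVneq l k'; first by move: xyk'; rewrite /absdiff /=; lia.
    by rewrite xE yE (negPf lk) (negPf lk') eqxx.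
  have [[cx [cy pq]]|/and3P[/B_crdP[m _ xyE] _ _]] := hyp.
    by apply: pq; apply: (@corners_diff1_pq02 x y k k') => //; rewrite eq_sym.
  have eqm l : (l == k) || (l == k') -> l = m.
    by rewrite -D => xyl; apply/eqP; apply: contraNT xyl => /xyE->.
  by move: k'k; rewrite (eqm k) ?eqxx // (eqm k') ?eqxx ?orbT.
(* ... or they differ only in k; as x lies strictly between them, their values
   there are 0 and 2. *)
have uvE l : l != k -> crd u l = crd v l.
  by move=> lk; have := kD l; rewrite lk => /negbFE/eqP.
have xk1 : crd_max k = 2 /\ crd x k = 1 /\
    (crd u k = 0 /\ crd v k = 2 \/ crd u k = 2 /\ crd v k = 0).
  have xvk : crd x k <> crd v k.
    move=> xvk; case/eqP: vx; apply: crd_inj => l.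
    by have [->//|lk] := eqVneq l k; rewrite xE (negPf lk) uvE.
  have := xE k; rewrite eqxx; have := crd_le u k; have := crd_le v k.
  by case: (k) uvk xvk => i /=; case: ifP; lia.
case: k xk1 => [i|i] [//= _ [xi uvi]] in uvk mx xE kD uvE *.
have ncx : ~~ corner x by apply/negP=> /cornerP/(_ i).
have [[cx _]|/and3P[/B_crdP[m _ xyE] _ cxy]] := hyp; first by rewrite cx in ncx.
have cy : corner y by rewrite (negPf ncx) in cxy.
have yi : crd y (inl i) <> 1 by apply/cornerP.
have yle := crd_le y (inl i).
(* The coordinate m of the edge xy is i: otherwise y_i = x_i = 1, but y is a
   corner.  So y agrees with u and v outside i, and y_i is 0 or 2. *)
have yE l : l != inl i -> crd y l = crd u l.
  have im : inl i = m.
    by apply/eqP; apply/negPn/negP => /xyE; rewrite [crd x _]xi => /esym.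
  by move=> li; rewrite -xyE -?im // xE (negPf li).
have [yu|yv] : crd y (inl i) = crd u (inl i) \/ crd y (inl i) = crd v (inl i).
- by move: yle yi; rewrite /=; lia.
- by case/eqP: uy; apply: crd_inj => l; have [->|/yE] := eqVneq l (inl i).
- case/eqP: vy; apply: crd_inj => l; have [->//|li] := eqVneq l (inl i).
  by rewrite yE // uvE.
Qed.

Lemma unblocked_pair x y :
    (corner x /\ corner y /\ (p x y, q x y) <> (0, 2)) \/ boundary_P3_edge x y ->
  unblocked (~: [set x; y]).
Proof.
move=> hyp u v; rewrite !notin_pair => /andP[ux uy] /andP[vx vy] uv.
apply/exists_inP; apply: contraT; rewrite negb_exists_in => /forall_inP stuck.
have blocked k : crd u k != crd v k -> move u v k = x \/ move u v k = y.
  move/stuck; rewrite notin_pair negb_and !negbK.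
  by case/orP=> /eqP; auto.
have hyp' : (corner y /\ corner x /\ (p y x, q y x) <> (0, 2)) \/
    boundary_P3_edge y x.
  case: hyp => [[cx [cy pq]]|]; last by rewrite boundary_P3_edge_sym; right.
  left; do 2![split=> //] => qp.
  have [i [j [ij D]]] := (corners_pq02P cy cx).1 qp.
  apply: pq; apply/(corners_pq02P cx cy); exists i, j; split=> // k.
  by rewrite eq_sym.
have [k uvk] := crd_neqP _ _ uv.
case: (blocked k uvk) => [/(blocked_move_neq hyp vx uy vy blocked uvk)//|].
have blocked' l : crd u l != crd v l -> move u v l = y \/ move u v l = x.
  by case/blocked; auto.
by move/(blocked_move_neq hyp' vy ux vx blocked' uvk).
Qed.

End Coordinates.

Theorem theorem13 (r s : nat) (x y : Bvertex r s) :
  x != y ->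
  ~: [set x; y] != set0 ->
  isometric (@B r s) (induced (@B r s) (~: [set x; y])) <->
  (corner x /\ corner y /\ (p x y, q x y) <> (0, 2)) \/ boundary_P3_edge x y.
Proof.
move=> _ _; split=> [/isometric_unblockedP free|hyp]; last first.
  exact/isometric_unblockedP/unblocked_pair.
have [cx|/(noncorner_boundary free)] := boolP (corner x); last by right.
have [cy|ncy] := boolP (corner y).
  by left; do 2![split=> //]; apply: corners_pq02_obstruct.
right; rewrite boundary_P3_edge_sym; apply: noncorner_boundary => //.
by rewrite setUC.
Qed.
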